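(* Let $\mu$ be a Radon measure on $\mathbb{R}^n$, let $1\leq m\leq n-1$ be an integer, let $s\in[m,n)$, and let $t\in[0,s)$. Then the measure $$\mu^t_{+}:=\mu\llcorner\left\{x\in\mathbb{R}^n: 0<\liminf_{r\downarrow 0} \frac{\mu(B(x,r))}{r^t} \leq \limsup_{r\downarrow 0} \frac{\mu(B(x,r))}{r^t}<\infty\right\}$$ is carried by $(m/s)$-Hölder $m$-cubes.
   Context: A Radon measure on $\mathbb{R}^n$ is a locally finite Borel regular outer measure. $B(x,r)$ is the closed ball with center $x$ and radius $r$. The restriction $\mu\llcorner E$ is defined by $(\mu\llcorner E)(F)=\mu(E\cap F)$ for all $F\subseteq\mathbb{R}^n$. An $(m/s)$-Hölder $m$-cube is a set $f([0,1]^m)\subseteq\mathbb{R}^n$, where $f:[0,1]^m\to\mathbb{R}^n$ satisfies $\sup_{x\ne y}|f(x)-f(y)|/|x-y|^{m/s}<\infty$. A measure $\nu$ on $\mathbb{R}^n$ is carried by $(m/s)$-Hölder $m$-cubes if there exist countably many $(m/s)$-Hölder $m$-cubes $\Gamma_i\subseteq\mathbb{R}^n$ with $\nu(\mathbb{R}^n\setminus\bigcup_i\Gamma_i)=0$. *)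

(* Defs.v *)
From HB Require Import structures.
From mathcomp Require Import all_boot all_order all_algebra.
From mathcomp Require Import all_classical all_reals all_analysis.

Set Implicit Arguments.
Unset Strict Implicit.
Unset Printing Implicit Defensive.

Import Order.TTheory GRing.Theory Num.Theory.
Import numFieldNormedType.Exports.

Local Open Scope classical_set_scope.
Local Open Scope ring_scope.

(* The norm `|x| of the library on 'rV[R]_n is the sup norm, hence the explicit
   Euclidean norm.  Both induce the library topology of 'rV[R]_n, which is the
   one used below for open sets and neighborhoods. *)
Definition enorm (R : realType) (n : nat) (x : 'rV[R]_n) : R :=
  Num.sqrt (\sum_(i < n) x ord0 i ^+ 2).

Definition eball (R : realType) (n : nat) (x : 'rV[R]_n) (r : R) :
    set 'rV[R]_n :=
  [set y | enorm (y - x) <= r].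

Definition borel (R : realType) (n : nat) : set_system 'rV[R]_n :=
  <<s [set U | open U] >>.

Definition locally_finite (R : realType) (n : nat)
    (mu : set 'rV[R]_n -> \bar R) : Prop :=
  forall x : 'rV[R]_n, exists2 U, nbhs x U & (mu U < +oo)%E.

Definition borel_regular (R : realType) (n : nat)
    (mu : {outer_measure set 'rV[R]_n -> \bar R}) : Prop :=
  (forall B, borel B -> mu.-caratheodory B) /\
  (forall A, exists B, [/\ borel B, A `<=` B & mu B = mu A]).

Definition radon (R : realType) (n : nat)
    (mu : {outer_measure set 'rV[R]_n -> \bar R}) : Prop :=
  locally_finite mu /\ borel_regular mu.

(* Unlike the library's [mrestr], this restricts an outer measure, to an
   arbitrary set. *)
Definition orestr (R : realType) (T : Type) (mu : set T -> \bar R) (E : set T) :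
    set T -> \bar R :=
  fun F => mu (E `&` F).

Definition unit_cube (R : realType) (m : nat) : set 'rV[R]_m :=
  [set x | forall i, 0 <= x ord0 i <= 1].

(* The supremum is taken in \bar R, so that it is +oo for an unbounded set of
   quotients.  Only the values of f on the unit cube matter. *)
Definition hoelder_on_cube (R : realType) (m n : nat) (a : R)
    (f : 'rV[R]_m -> 'rV[R]_n) : Prop :=
  (ereal_sup [set q | exists x y : 'rV[R]_m,
     [/\ unit_cube x, unit_cube y, x <> y &
         q = (enorm (f x - f y) / enorm (x - y) `^ a)%:E]] < +oo)%E.

Definition hoelder_cube (R : realType) (m n : nat) (a : R)
    (G : set 'rV[R]_n) : Prop :=
  exists2 f : 'rV[R]_m -> 'rV[R]_n, hoelder_on_cube a f & G = f @` @unit_cube R m.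

Definition carried_by_hoelder_cubes (R : realType) (m n : nat) (a : R)
    (nu : set 'rV[R]_n -> \bar R) : Prop :=
  exists C : set (set 'rV[R]_n),
    [/\ countable C,
        (forall G, C G -> hoelder_cube m a G) &
        nu (~` \bigcup_(G in C) G) = 0%E].

Definition density_ratio (R : realType) (n : nat) (t : R)
    (mu : set 'rV[R]_n -> \bar R) (x : 'rV[R]_n) (r : R) : \bar R :=
  (mu (eball x r) * ((r `^ t)^-1)%:E)%E.

Definition lower_density (R : realType) (n : nat) (t : R)
    (mu : set 'rV[R]_n -> \bar R) (x : 'rV[R]_n) : \bar R :=
  limf_einf (density_ratio t mu x) (0 : R)^'+.

Definition upper_density (R : realType) (n : nat) (t : R)
    (mu : set 'rV[R]_n -> \bar R) (x : 'rV[R]_n) : \bar R :=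
  limf_esup (density_ratio t mu x) (0 : R)^'+.

Definition mu_plus (R : realType) (n : nat) (t : R)
    (mu : set 'rV[R]_n -> \bar R) : set 'rV[R]_n -> \bar R :=
  orestr mu [set x | (0 < lower_density t mu x)%E /\
                     (lower_density t mu x <= upper_density t mu x)%E /\
                     (upper_density t mu x < +oo)%E].

(* Main.v *)
(* Decompose the set of the theorem into countably many sets E of small diameter
   on which c r^t <= mu(B(x,r)) <= C r^t for all small r, uniformly in x.
   Comparing the measure of disjoint small balls with that of a large one, an
   r-separated subset of E of diameter d has at most K (d/r)^t points.  Hence, if
   D is even and large, a piece of E of diameter d splits into (D/2)^m pieces of
   diameter D^(-m/s) d: this is where t < s is used.  Iterating, every point of
   E receives an infinite address over an alphabet of (D/2)^m letters, that is,
   m sequences of even digits in base D, which are the coordinates of a point of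
   a Cantor set in [0,1]^m.  Points first separated at level k are at distance at
   least D^-(k+1) in the cube and at most a constant times D^(-k m/s) in E, so
   decoding is (m/s)-Hoelder on the Cantor set, and it extends to the cube since
   m/s <= 1. *)

Require Import Defs.
From HB Require Import structures.
From mathcomp Require Import all_boot all_order all_algebra.
From mathcomp Require Import all_classical all_reals all_analysis.
From mathcomp Require Import ring lra.

Set Implicit Arguments.
Unset Strict Implicit.
Unset Printing Implicit Defensive.

Import Order.TTheory GRing.Theory Num.Theory.
Import numFieldNormedType.Exports.

Local Open Scope classical_set_scope.
Local Open Scope ring_scope.

(** * Subadditive powers; the sup norm against the Euclidean norm *)

Lemma powRD_le (R : realType) (a u v : R) :
  0 < a <= 1 -> 0 <= u -> 0 <= v -> (u + v) `^ a <= u `^ a + v `^ a.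
Proof.
move=> /andP[a0 a1] u0 v0.
have [w0|w0] := eqVneq (u + v) 0.
  by rewrite w0 powR0 ?gt_eqF// addr_ge0// powR_ge0.
have wp : 0 < u + v by rewrite lt_neqAle eq_sym w0 addr_ge0.
(* The ratio [x / (u + v)] lies in [0, 1], so its power with exponent [a <= 1] is at least itself;
   the cases [u] and [v] add up to the claim. *)
suff H x : 0 <= x <= u + v -> (u + v) `^ a * (x / (u + v)) <= x `^ a.
  have Hu : 0 <= u <= u + v by rewrite u0 lerDl.
  have Hv : 0 <= v <= u + v by rewrite v0 lerDr.
  rewrite (le_trans _ (lerD (H _ Hu) (H _ Hv)))//.
  by rewrite -mulrDr -mulrDl divff// mulr1.
move=> /andP[]; rewrite le_eqVlt => /predU1P[<- _|x0 xw].
  by rewrite mul0r mulr0 powR_ge0.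
rewrite -[in leRHS](divfK w0 x) powRM ?divr_ge0 ?(ltW x0) ?(ltW wp)//.
rewrite mulrC ler_wpM2r ?powR_ge0// ger1_powR//.
by rewrite divr_gt0//= ler_pdivrMr// mul1r.
Qed.

Lemma coord_le_norm (R : realType) (n : nat) (x : 'rV[R]_n) (i : 'I_n) :
  `|x ord0 i| <= `|x|.
Proof.
by rewrite [leRHS]/Num.norm /= mx_normrE; apply/bigmax_geP; right;
  exists (ord0, i).
Qed.

Lemma norm_le_coord (R : realType) (n : nat) (x : 'rV[R]_n) (c : R) :
  0 <= c -> (forall i, `|x ord0 i| <= c) -> `|x| <= c.
Proof.
move=> c0 xc; rewrite [leLHS]/Num.norm /= mx_normrE; apply/bigmax_leP.
by split => // -[j i] _ /=; rewrite ord1.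
Qed.

Lemma enorm_ge_norm (R : realType) (n : nat) (x : 'rV[R]_n) : `|x| <= enorm x.
Proof.
apply: norm_le_coord => [|i]; first exact: sqrtr_ge0.
rewrite -sqrtr_sqr /enorm ler_wsqrtr// (bigD1 i)//= lerDl.
by apply: sumr_ge0 => j _; exact: sqr_ge0.
Qed.

Lemma enorm_le_norm (R : realType) (n : nat) (x : 'rV[R]_n) :
  enorm x <= n%:R * `|x|.
Proof.
rewrite -[leRHS]ger0_norm ?mulr_ge0// -sqrtr_sqr /enorm ler_wsqrtr//.
have H : \sum_(i < n) x ord0 i ^+ 2 <= \sum_(i < n) `|x| ^+ 2.
  apply: ler_sum => i _; rewrite -real_normK ?num_real// lerXn2r ?nnegrE//.
  exact: coord_le_norm.
rewrite (le_trans H)// sumr_const card_ord -[leLHS]mulr_natl exprMn.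
by rewrite ler_wpM2r ?sqr_ge0// -natrX ler_nat; case: (n) => // k;
  rewrite expnS leq_pmulr// expn1.
Qed.

Lemma borel_eball (R : realType) (n : nat) (x : 'rV[R]_n) (r : R) :
  borel (eball x r).
Proof.
suff cl : closed (eball x r).
  rewrite -[eball x r]setCK; apply: sigma_algebraC.
  by apply: sub_sigma_algebra; exact: closed_openC.
pose q (y : 'rV[R]_n) := \sum_(i < n) (y ord0 i - x ord0 i) ^+ 2.
have cq : continuous q.
  apply: continuous_big => [|i _ y]; first exact: add_continuous.
  have H : {for y, continuous (fun z : 'rV[R]_n => z ord0 i - x ord0 i)}.
    by apply: continuousB; [exact: coord_continuous|exact: cst_continuous].
  exact: (continuousM H H).
have -> : eball x r = (Num.sqrt \o q) @^-1` [set z | z <= r].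
  apply/seteqP; split => y; rewrite /eball /enorm /=;
    by under eq_bigr do rewrite !mxE.
apply: preimage_closed; last exact: closed_le.
by move=> y _; apply: continuous_comp; [exact: cq|exact: sqrt_continuous].
Qed.

(** * Hölder maps on the cube: change of norm and extension *)

Lemma hoelder_on_cubeP (R : realType) (m n : nat) (a L : R)
    (f : 'rV[R]_m -> 'rV[R]_n) :
  (forall x y, `|f x - f y| <= L * `|x - y| `^ a) -> 0 < a -> 0 <= L ->
  hoelder_on_cube a f.
Proof.
(* The factor [n] pays for the Euclidean norm in the target; in the source the comparison of norms
   costs nothing. *)
move=> fL a0 L0; apply: (@le_lt_trans _ _ (n%:R * L)%:E); last exact: ltry.
apply: ge_ereal_sup => _ [x [y [_ _ xy ->]]]; rewrite lee_fin.
have xyp : 0 < enorm (x - y).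
  by rewrite (lt_le_trans _ (enorm_ge_norm _))// normr_gt0 subr_eq0; exact/eqP.
rewrite ler_pdivrMr ?powR_gt0// (le_trans (enorm_le_norm _))// -mulrA.
rewrite ler_wpM2l// (le_trans (fL _ _))// ler_wpM2l//.
by rewrite ge0_ler_powR ?nnegrE ?(ltW a0) ?(ltW xyp)//; exact: enorm_ge_norm.
Qed.

(* McShane's extension, applied to each coordinate of the inverse of g. *)
Lemma hoelder_inverse (R : realType) (m n : nat) (a L : R) (E : set 'rV[R]_n)
    (g : 'rV[R]_n -> 'rV[R]_m) :
  0 < a <= 1 -> 0 <= L ->
  (forall x y, E x -> E y -> `|x - y| <= L * `|g x - g y| `^ a) ->
  exists2 f, hoelder_on_cube a f & forall x, E x -> f (g x) = x.
Proof.
move=> a01 L0 gL; have /andP[a0 a1] := a01.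
have [E0|/set0P[e0 Ee0]] := eqVneq E set0.
  exists (fun=> 0); last by rewrite E0.
  apply: (@hoelder_on_cubeP _ _ _ _ L) => // x y.
  by rewrite subrr normr0 mulr_ge0// powR_ge0.
pose S p i := [set e ord0 i + L * `|p - g e| `^ a | e in E].
(* As [a <= 1], the [a]-th power of the distance still satisfies the triangle inequality, so
   McShane's formula for Lipschitz functions applies. *)
have powD (p q r : 'rV[R]_m) : `|p - r| `^ a <= `|p - q| `^ a + `|q - r| `^ a.
  apply: le_trans (powRD_le _ _ _) => //.
  apply: ge0_ler_powR; rewrite ?nnegrE ?(ltW a0)// ?addr_ge0//.
  by rewrite -(subrKA q) ler_normD.
have coordL x y i : E x -> E y -> x ord0 i <= y ord0 i + L * `|g x - g y| `^ a.
  move=> Ex Ey; rewrite -lerBlDl (le_trans (ler_norm _))//.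
  have := coord_le_norm (x - y) i; rewrite !mxE => /le_trans; apply.
  exact: gL.
(* Without a lower bound, [inf] would be a mere default value. *)
have Slb p i : lbound (S p i) (e0 ord0 i - L * `|g e0 - p| `^ a).
  move=> _ [e Ee <-]; rewrite lerBlDr -addrA -mulrDr.
  rewrite (le_trans (coordL _ _ i Ee0 Ee))// lerD2l ler_wpM2l// [leRHS]addrC.
  exact: powD.
have S0 p i : S p i !=set0 by eexists; exists e0.
have lip p q i : inf (S p i) - inf (S q i) <= L * `|p - q| `^ a.
  rewrite lerBlDr -lerBlDl; apply: lb_le_inf => // _ [e Ee <-].
  rewrite lerBlDl; apply: (@le_trans _ _ (e ord0 i + L * `|p - g e| `^ a)).
    by apply: ge_inf; [eexists; exact: Slb|exists e].
  by rewrite addrCA -mulrDr lerD2l ler_wpM2l// powD.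
exists (fun p => \row_i inf (S p i)) => [|x Ex].
  apply: (@hoelder_on_cubeP _ _ _ _ L) => // p q.
  apply: norm_le_coord => [|i]; first by rewrite mulr_ge0// powR_ge0.
  by rewrite !mxE ler_norml lip andbT lerNl opprB distrC lip.
(* The competitor [e = x] gives one inequality, the hypothesis on [g] the other. *)
apply/rowP => i; rewrite mxE; apply/eqP; rewrite eq_le; apply/andP; split.
  apply: ge_inf; first by eexists; exact: Slb.
  by exists x => //; rewrite subrr normr0 powR0 ?gt_eqF// mulr0 addr0.
by apply: lb_le_inf => // _ [e Ee <-]; exact: coordL.
Qed.

(** * Points of a Cantor set, with even digits in base [2M] *)

Definition cantor_sum (R : realType) (M : nat) (a : nat -> nat) (k : nat) : R :=
  \sum_(j < k) (a j).*2%:R * (M.*2%:R^-1) ^+ j.+1.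

Definition cantor_point (R : realType) (M : nat) (a : nat -> nat) : R :=
  sup (range (cantor_sum R M a)).

Lemma cantor_sum_homo (R : realType) (M : nat) (a : nat -> nat) :
  {homo cantor_sum R M a : k l / (k <= l)%N >-> k <= l}.
Proof.
apply/nondecreasing_seqP => k; rewrite /cantor_sum big_ord_recr /= lerDl.
by rewrite mulr_ge0// exprn_ge0// invr_ge0.
Qed.

Lemma cantor_sum_tail (R : realType) (M : nat) (a : nat -> nat) :
  (forall j, (a j < M)%N) ->
  {homo (fun k => cantor_sum R M a k + (M.*2%:R^-1) ^+ k) :
     k l / (k <= l)%N >-> l <= k}.
Proof.
move=> aM; apply/nonincreasing_seqP => k.
rewrite /cantor_sum big_ord_recr /= -addrA lerD2l exprS.
set b := M.*2%:R^-1.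
have M0 : (0 < M)%N by rewrite (leq_ltn_trans _ (aM 0%N)).
rewrite mulrA -mulrDl -[leRHS]mul1r ler_wpM2r ?exprn_ge0 ?invr_ge0//.
rewrite -[X in _ + X]mul1r -mulrDl /b ler_pdivrMr ?ltr0n ?double_gt0//.
by rewrite mul1r natr1 ler_nat ltn_double.
Qed.

(** The intervals are nested in [k], by the two monotonicities above; level 0 places the point in
    [0, 1]. *)
Lemma cantor_point_bounds (R : realType) (M : nat) (a : nat -> nat) (k : nat) :
  (forall j, (a j < M)%N) ->
  cantor_sum R M a k <= cantor_point R M a <=
  cantor_sum R M a k + (M.*2%:R^-1) ^+ k.
Proof.
move=> aM.
have ub : ubound (range (cantor_sum R M a))
    (cantor_sum R M a k + (M.*2%:R^-1) ^+ k).
  move=> _ [l _ <-]; apply: le_trans (cantor_sum_homo _ _ _ (leq_maxl l k)) _.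
  apply: le_trans (cantor_sum_tail R aM (leq_maxr l k)).
  by rewrite lerDl exprn_ge0// invr_ge0.
have S0 : range (cantor_sum R M a) !=set0 by exists (cantor_sum R M a 0), 0%N.
apply/andP; split; last exact: ge_sup.
by apply: sup_upper_bound; [split => //; eexists; exact: ub|exists k].
Qed.

(* Only even digits in base 2M are used: this is what leaves the gap. *)
Lemma cantor_point_gap (R : realType) (M : nat) (a b : nat -> nat) (k : nat) :
  (forall j, (a j < M)%N) -> (forall j, (b j < M)%N) ->
  (forall j, (j < k)%N -> a j = b j) -> a k != b k ->
  (M.*2%:R^-1) ^+ k.+1 <= `|cantor_point R M a - cantor_point R M b|.
Proof.
move=> aM bM ab abk.
wlog : a b aM bM ab abk / (a k < b k)%N => [H|lt_ab].
  case: (ltngtP (a k) (b k)) => [|lt_ba|eq_ab]; first exact: H.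
    rewrite distrC; apply: H => //; last by rewrite eq_sym.
    by move=> j /ab.
  by rewrite eq_ab eqxx in abk.
rewrite distrC (le_trans _ (ler_norm _))// lerBrDr.
have /andP[_ a2] := cantor_point_bounds R k.+1 aM.
have /andP[b1 _] := cantor_point_bounds R k.+1 bM.
rewrite (le_trans _ b1)// (le_trans (lerD (lexx _) a2))//.
rewrite /cantor_sum !big_ord_recr /=.
under [X in _ + (X + _ + _)]eq_bigr => j _ do rewrite ab//.
set u := _ ^+ k.+1; rewrite addrCA -addrA lerD2l.
have u0 : 0 <= u by rewrite exprn_ge0// invr_ge0.
(* The larger digit puts [b] ahead by at least [2u], and the tail of [a] makes up at most [u]. *)
have -> : (a k).*2%:R * u + (u + u) = ((a k).*2.+2)%:R * u.
  by rewrite -!natr1; ring.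
by rewrite ler_wpM2r// ler_nat -doubleS leq_double.
Qed.

(** * Separated families, colorings and addresses *)

Definition separated_seq (R : realType) (V : normedZmodType R) (r : R)
    (z : seq V) :=
  pairwise (fun x y => r < `|x - y|) z.

Definition diam_le (R : realType) (V : normedZmodType R) (P : set V) (d : R) :=
  forall x y, P x -> P y -> `|x - y| <= d.

(** A separated sequence of maximal length is a net: a point farther than [r] from all its members
    could be added. *)
Lemma separated_net (R : realType) (V : normedZmodType R) (P : set V) (r : R)
    (N : nat) :
  (forall z, [set` z] `<=` P -> separated_seq r z -> (size z <= N)%N) ->
  exists z : seq V, [/\ (size z <= N)%N, separated_seq r z &
    forall x, P x -> has (fun y => `|x - y| <= r) z].
Proof.
move=> zN.
pose Q k :=
  `[< exists z, [/\ [set` z] `<=` P, separated_seq r z & size z = k] >].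
have Q0 : exists k, Q k by exists 0%N; apply/asboolP; exists [::].
have QN k : Q k -> (k <= N)%N by move=> /asboolP[z [zP sz <-]]; exact: zN.
case: (ex_maxnP Q0 QN) => k /asboolP[z [zP sz zk]] kmax.
exists z; split => //; first exact: zN.
move=> x Px; apply: contrapT => /negP; rewrite -all_predC => xz.
suff : (k.+1 <= k)%N by rewrite ltnn.
apply: kmax; apply/asboolP; exists (x :: z); split; last by rewrite /= zk.
  by move=> y /=; rewrite inE => /predU1P[->//|]; exact: zP.
apply/andP; split => //; apply: sub_all xz => y /=.
by rewrite -ltNge.
Qed.

(** Each point is colored by the first net point within [r] of it, so points of equal color are both
    close to the same net point. *)
Lemma small_coloring (R : realType) (V : normedZmodType R) (P : set V) (r : R)
    (C : finType) :
  (0 < #|C|)%N ->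
  (forall z, [set` z] `<=` P -> separated_seq r z -> (size z <= #|C|)%N) ->
  exists c : V -> C, forall x y, P x -> P y -> c x = c y -> `|x - y| <= r + r.
Proof.
move=> /card_gt0P[c0 _] /separated_net[z [zC _ zP]].
pose f x := find (fun y => `|x - y| <= r) z.
have fz x : P x -> (f x < size z)%N by rewrite -has_find; exact: zP.
exists (fun x => nth c0 (enum C) (f x)) => x y Px Py /eqP.
rewrite nth_uniq ?enum_uniq -?cardE ?(leq_trans (fz _ _) zC)// => /eqP fxy.
have Hx := nth_find 0 (zP x Px); have Hy := nth_find 0 (zP y Py).
rewrite -(subrKA (nth 0 z (f x))) (le_trans (ler_normD _ _))// lerD//.
by rewrite distrC fxy.
Qed.

(* The pieces of level k are the sets of points sharing their first k colors;
   the coloring used at level k depends on the piece. *)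
Lemma address (R : realType) (V : normedZmodType R) (C : Type) (E : set V)
    (d : nat -> R) :
  (forall k P, P `<=` E -> diam_le P (d k) ->
     exists c : V -> C, forall x y, P x -> P y -> c x = c y ->
       `|x - y| <= d k.+1) ->
  diam_le E (d 0%N) ->
  exists w : V -> nat -> C, forall k x y, E x -> E y ->
    (forall j, (j < k)%N -> w x j = w y j) -> `|x - y| <= d k.
Proof.
move=> colorable diamE.
(* Supplies a default coloring for the pairs that violate the premises in the next choice. *)
have [c0 _] := colorable 0%N E (@subset_refl _ E) diamE.
have /choice[col colP] (p : nat * set V) : exists c : V -> C,
    p.2 `<=` E -> diam_le p.2 (d p.1) ->
    forall x y, p.2 x -> p.2 y -> c x = c y -> `|x - y| <= d p.1.+1.
  have [[PE dP]|H] := pselect (p.2 `<=` E /\ diam_le p.2 (d p.1)).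
    by have [c cP] := colorable _ _ PE dP; exists c.
  by exists c0 => PE dP; case: H.
pose fix piece (k : nat) (x : V) {struct k} : set V := if k is k'.+1 then
  [set y | piece k' x y /\ col (k', piece k' x) y = col (k', piece k' x) x]
  else E.
have pieceE k x : piece k x `<=` E.
  by elim: k => [|k IH] //= y [/IH].
have piece_diam k x : diam_le (piece k x) (d k).
  elim: k => [//|k IH] y z /= [ky cy] [kz cz].
  by apply: (colP (k, piece k x)) => //=; rewrite cy cz.
have piece_refl k x : E x -> piece k x x by move=> Ex; elim: k => //=.
pose w x k := col (k, piece k x) x.
(* Equality of the pieces as sets is what makes [x] and [y] use the same coloring at the next
   level. *)
have piece_eq k x y : E x -> E y -> (forall j, (j < k)%N -> w x j = w y j) ->
    piece k x = piece k y.
  move=> Ex Ey; elim: k => [//|k IH] wxy /=.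
  have e : piece k x = piece k y by apply: IH => j jk; apply: wxy; exact: ltnW.
  by have := wxy k (ltnSn k); rewrite /w e => ->.
exists w => k x y Ex Ey wxy; apply: (piece_diam k x); first exact: piece_refl.
by rewrite (piece_eq k x y)//; exact: piece_refl.
Qed.

(** * A single cube covering a set with a packing bound *)

Lemma digit_base (R : realType) (m : nat) (K a t : R) :
  a * t < m%:R ->
  exists2 M : nat, (0 < M)%N & K * (2 * M.*2%:R `^ a) `^ t <= M%:R ^+ m.
Proof.
(* With [D = 2M] the claim reads [K * 2]^ t * 2 ^+ m <= D [^ e], true for large [D] since
   [e > 0]. *)
move=> atm; pose e := m%:R - a * t.
have e0 : 0 < e by rewrite subr_gt0.
pose B := Num.max 0 (K * 2 `^ t * 2 ^+ m).
have B0 : 0 <= B by rewrite le_max lexx.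
exists (Num.bound (B `^ e^-1)).
  by rewrite -(ltr_nat R) (le_lt_trans _ (archi_boundP _)) ?powR_ge0.
set M := Num.bound _.
have BM : B `^ e^-1 < M%:R by rewrite archi_boundP// powR_ge0.
have M0 : 0 < M%:R :> R by rewrite (le_lt_trans _ BM)// powR_ge0.
set D : R := M.*2%:R.
have D2 : D = 2 * M%:R by rewrite /D -mul2n natrM.
have D0 : 0 < D by rewrite D2 mulr_gt0.
have BD : B <= D `^ e.
  rewrite -[B]powRr1// -(mulVf (lt0r_neq0 e0)) powRrM.
  apply: ge0_ler_powR; rewrite ?nnegrE ?powR_ge0 ?(ltW e0) ?(ltW D0)//.
  by rewrite (le_trans (ltW BM))// D2 ler_peMl ?(ltW M0)// ler1n.
rewrite powRM ?powR_ge0// -powRrM mulrA.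
rewrite -(ler_pM2r (exprn_gt0 m (ltr0Sn R 1))) -exprMn [M%:R * _]mulrC -D2.
rewrite -[D ^+ m]powR_mulrn ?(ltW D0)// -[m%:R](subrK (a * t)).
rewrite [D `^ (_ + _)]powRD; last first.
  by rewrite lt0r_neq0// implybT.
rewrite mulrAC ler_wpM2r ?powR_ge0// (le_trans _ BD)//.
by rewrite /B le_max lexx orbT.
Qed.

Lemma hoelder_cube_cover (R : realType) (m n : nat) (s t K d0 : R)
    (E : set 'rV[R]_n) :
  (0 < m)%N -> m%:R <= s -> t < s -> 0 < d0 -> diam_le E d0 ->
  (forall (d r : R) (z : seq 'rV[R]_n),
     0 < r -> r <= d -> d <= d0 -> [set` z] `<=` E ->
     diam_le [set` z] d -> separated_seq r z ->
     (size z)%:R <= K * (d / r) `^ t) ->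
  exists2 G, hoelder_cube m (m%:R / s) G & E `<=` G.
Proof.
move=> m0 ms ts d00 diamE packE.
have mR0 : 0 < m%:R :> R by rewrite ltr0n.
have s0 : 0 < s by rewrite (lt_le_trans mR0).
set a := m%:R / s.
have a0 : 0 < a by rewrite divr_gt0.
have a1 : a <= 1 by rewrite ler_pdivrMr// mul1r.
have atm : a * t < m%:R.
  by rewrite /a mulrAC ltr_pdivrMr// ltr_pM2l.
have [M M0 KM] := digit_base K atm.
have D0 : 0 < M.*2%:R :> R by rewrite ltr0n double_gt0.
set b : R := M.*2%:R^-1.
have b0 : 0 < b by rewrite invr_gt0.
have b1 : b < 1 by rewrite invf_lt1// ltr1n -addnn (leq_add M0 M0).
(* Diameters in [E] shrink by [rho] while the cube shrinks by [b]; this fixes the Hölder exponent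
   [a]. *)
pose rho := b `^ a.
have rho0 : 0 < rho by rewrite powR_gt0.
have rho1 : rho < 1.
  by have := gt0_ltr_powR a0 _ _ b1; rewrite powR1 !nnegrE; apply; rewrite ?ltW.
have rhoV : rho^-1 = M.*2%:R `^ a.
  by rewrite /rho -powRN /b -powR_inv1 ?(ltW D0)// -powRrM mulN1r opprK.
pose d k := rho ^+ k * d0.
have dgt0 k : 0 < d k by rewrite mulr_gt0// exprn_gt0.
(* A coloring yields diameters of twice the net radius, hence the radius [rho * d k / 2]. *)
have dS k : d k.+1 = rho * d k / 2 + rho * d k / 2.
  by rewrite -splitr /d exprS mulrA.
have d_le k : d k <= d0.
  by rewrite ger_pMl// exprn_ile1 ?ltW.
(* A color consists of [m] digits, one for each coordinate of the cube. *)
pose C : finType := {ffun 'I_m -> 'I_M}.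
have cardC : #|C| = (M ^ m)%N by rewrite card_ffun !card_ord.
have [w wP] : exists w : 'rV[R]_n -> nat -> C, forall k x y, E x -> E y ->
    (forall j, (j < k)%N -> w x j = w y j) -> `|x - y| <= d k.
  apply: address; last by rewrite /d expr0 mul1r.
  move=> k P PE dP; rewrite dS; apply: small_coloring.
    by rewrite cardC expn_gt0 M0.
  move=> z zP sz; rewrite cardC -(ler_nat R) natrX (le_trans _ KM)//.
  have -> : 2 * M.*2%:R `^ a = d k / (rho * d k / 2).
    by rewrite -rhoV; field; rewrite !lt0r_neq0.
  apply: packE => //; first by rewrite divr_gt0// mulr_gt0.
  - rewrite -[leRHS]mul1r mulrAC ler_wpM2r ?(ltW (dgt0 _))//.
    by rewrite ler_pdivrMr// mul1r (le_trans (ltW rho1))// ler1n.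
  - exact: subset_trans zP PE.
  - by move=> x y /zP Px /zP Py; exact: dP.
pose g x : 'rV[R]_m := \row_i cantor_point R M (fun j => w x j i).
have gcube x : unit_cube (g x).
  move=> i; rewrite mxE.
  have := @cantor_point_bounds R M (fun j => w x j i) 0%N (fun j => ltn_ord _).
  by rewrite /cantor_sum big_ord0 expr0 add0r.
have L0 : 0 <= d0 / rho by rewrite divr_ge0// ltW.
have a01 : 0 < a <= 1 by rewrite a0.
have [|f fh fg] := @hoelder_inverse R m n a (d0 / rho) E g a01 L0.
  move=> x y Ex Ey; have [->|xy] := eqVneq x y.
    by rewrite subrr normr0 mulr_ge0// powR_ge0.
  (* Distinct points have distinct addresses because [d k] tends to 0. *)
  have diff : exists k, w x k != w y k.
    apply: contrapT => same.
    have small k : `|x - y| <= d k.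
      apply: wP => // j _; apply: contrapT => /eqP jP; apply: same.
      by exists j.
    have dlim : d @ \oo --> 0.
      rewrite -(mul0r d0); apply: cvgMl; apply: cvg_expr.
      by rewrite ger0_norm ?ltW.
    have : `|x - y| <= 0.
      exact: (cvgr_to_ge dlim (nearW _ small)).
    by rewrite normr_le0 subr_eq0 (negPf xy).
  case: (ex_minnP diff) => k wk kmin.
  have wlt j : (j < k)%N -> w x j = w y j.
    by move=> jk; apply/eqP; apply: contraTT jk => /kmin; rewrite -leqNgt.
  have [i wi] : exists i, w x k i != w y k i.
    apply: contrapT => H; move/eqP: wk; apply; apply/ffunP => i.
    by apply: contrapT => /eqP wi; apply: H; exists i.
  have gap : b ^+ k.+1 <= `|g x - g y|.
    apply: le_trans (coord_le_norm _ i); rewrite !mxE.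
    by apply: cantor_point_gap => // j /wlt ->.
  apply: le_trans (wP k x y Ex Ey wlt) _.
  (* Level [k] in [E] faces the gap [b ^+ k.+1] in the cube; this shift by one level is the factor
     [rho^-1] in the Hölder constant. *)
  have -> : d k = d0 / rho * (b ^+ k.+1) `^ a.
    rewrite -powR_mulrn ?(ltW b0)// powRAC powR_mulrn ?(ltW rho0)// -/rho.
    by rewrite /d exprS; field; rewrite lt0r_neq0.
  rewrite ler_wpM2l// ge0_ler_powR ?nnegrE ?(ltW a0)// exprn_ge0//.
  exact: ltW.
exists (f @` @unit_cube R m); first by exists f.
by move=> x Ex; exists (g x); [exact: gcube|exact: fg].
Qed.

(** * Packing bounds from the measure of balls *)

Lemma outer_measure_ge_sum (R : realType) (T : Type) (I : eqType)
    (mu : {outer_measure set T -> \bar R}) (A : I -> set T) (z : seq I)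
    (X : set T) :
  (forall i, mu.-caratheodory (A i)) ->
  pairwise (fun i j => `[< [disjoint A i & A j] >]) z ->
  (forall i, i \in z -> A i `<=` X) ->
  (\sum_(i <- z) mu (A i) <= mu X)%E.
Proof.
move=> mA; elim: z X => [|i z IH] X /=.
  by rewrite big_nil outer_measure_ge0.
(* Carathéodory's condition for the head splits [mu X]; the remaining sets, disjoint from the head,
   lie in the other part. *)
move=> /andP[/allP iz zz] AX; rewrite big_cons (mA i X) leeD//.
  by apply: le_outer_measure => x Ax; split => //; apply: AX Ax;
    rewrite mem_head.
apply: IH => // j jz x Ajx; split; first by apply: AX Ajx; rewrite inE jz orbT.
move=> Aix; have /asboolP/eqP := iz j jz.
by move=> /seteqP[/(_ x (conj Aix Ajx))].
Qed.

Definition ahlfors_at (R : realType) (n : nat) (mu : set 'rV[R]_n -> \bar R)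
    (t a b delta : R) (x : 'rV[R]_n) :=
  forall r, 0 < r < delta ->
    ((a * r `^ t)%:E <= mu (eball x r) <= (b * r `^ t)%:E)%E.

(** The balls of radius [r / 2] about the points of [z] are disjoint and lie in one ball of radius
    [n * 2d]; the ratio of the radii is [4n * d / r]. The factor [n] appears because diameters use
    the sup norm and balls the Euclidean one. *)
Lemma ahlfors_packing (R : realType) (n : nat)
    (mu : {outer_measure set 'rV[R]_n -> \bar R}) (t a b delta d0 : R)
    (E : set 'rV[R]_n) (d r : R) (z : seq 'rV[R]_n) :
  (forall B, borel B -> mu.-caratheodory B) -> (0 < n)%N ->
  0 < a -> 0 < b -> n%:R * (2 * d0) < delta ->
  E `<=` ahlfors_at mu t a b delta ->
  0 < r -> r <= d -> d <= d0 -> [set` z] `<=` E ->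
  diam_le [set` z] d -> separated_seq r z ->
  (size z)%:R <= b / a * (4 * n%:R) `^ t * (d / r) `^ t.
Proof.
move=> muB n0 a0 b0 d0delta Emu r0 rd dd0 zE zd sz.
have [->|zN0] := eqVneq z [::].
  by rewrite /= mulr_ge0 ?powR_ge0// mulr_ge0 ?powR_ge0// divr_ge0 ?ltW.
have [z0 z0z] : exists z0, z0 \in z.
  by case: (z) zN0 => // z0 z' _; exists z0; rewrite mem_head.
have n1 : 1 <= n%:R :> R by rewrite ler1n.
have nR0 : 0 < n%:R :> R by rewrite ltr0n.
have dp : 0 < d by rewrite (lt_le_trans r0).
have big_lt : n%:R * (2 * d) < delta.
  by rewrite (le_lt_trans _ d0delta)// ler_pM2l// ler_pM2l.
have small_lt : r / 2 < delta.
  rewrite (le_lt_trans _ big_lt)//.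
  have : 1 * (2 * d) <= n%:R * (2 * d) by rewrite ler_wpM2r// mulr_ge0// ltW.
  by lra.
have eballP x y e : eball x e y -> `|y - x| <= e.
  by move=> /(le_trans (enorm_ge_norm _)).
have sub y : y \in z -> eball y (r / 2) `<=` eball z0 (n%:R * (2 * d)).
  move=> yz p /eballP py; rewrite /eball /= (le_trans (enorm_le_norm _))//.
  rewrite ler_pM2l// -(subrKA y) (le_trans (ler_normD _ _))//.
  by have := zd _ _ yz z0z; lra.
have disj : pairwise
    (fun i j => `[< [disjoint eball i (r / 2) & eball j (r / 2)] >]) z.
  apply: sub_pairwise sz => x y rxy; apply/asboolP/eqP.
  rewrite -subset0 => p [/eballP px /eballP py].
  have := ler_normD (x - p) (p - y); rewrite subrKA (distrC x p).
  by lra.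
have := outer_measure_ge_sum (fun y => muB _ (borel_eball y (r / 2))) disj sub.
have /Emu/(_ (n%:R * (2 * d))) Hz0 := zE _ z0z.
rewrite big_lt andbT !mulr_gt0// in Hz0; have /andP[_ Hz] := Hz0 isT.
move=> /le_trans/(_ Hz) {Hz Hz0}.
have lb : ((\sum_(y <- z) (a * (r / 2) `^ t))%:E <=
    \sum_(y <- z) mu (eball y (r / 2)))%E.
  rewrite -sumEFin big_seq [leRHS]big_seq; apply: lee_sum => y yz.
  have /Emu/(_ (r / 2)) := zE _ yz.
  by rewrite small_lt divr_gt0// => /(_ isT)/andP[].
move=> /(le_trans lb); rewrite lee_fin big_const_seq count_predT iter_addr_0.
rewrite -[leLHS]mulr_natl.
have r2t : 0 < (r / 2) `^ t by rewrite powR_gt0// divr_gt0.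
rewrite -ler_pdivlMr ?mulr_gt0// => /le_trans; apply.
have -> : n%:R * (2 * d) = 4 * n%:R * (d / r) * (r / 2).
  by field; exact: lt0r_neq0.
have v0 : 0 <= d / r by rewrite divr_ge0 ?ltW.
have w0 : 0 <= r / 2 by rewrite divr_ge0 ?ltW.
have u0 : 0 <= 4 * n%:R :> R by rewrite mulr_ge0.
rewrite (powRM _ (mulr_ge0 u0 v0) w0) (powRM _ u0 v0).
rewrite le_eqVlt; apply/orP; left; apply/eqP; field.
by rewrite !lt0r_neq0.
Qed.

(** * Decomposition into countably many uniform pieces *)

Lemma density_bounds (R : realType) (n : nat) (t : R)
    (mu : set 'rV[R]_n -> \bar R) (x : 'rV[R]_n) :
  (0 < lower_density t mu x)%E -> (upper_density t mu x < +oo)%E ->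
  exists N : nat, ahlfors_at mu t N.+1%:R^-1 N.+1%:R N.+1%:R^-1 x.
Proof.
rewrite /lower_density limf_einfE => /ereal_sup_gt[_ [V V0 <-]] infV.
rewrite /upper_density limf_esupE => /ereal_inf_lt[_ [W W0 <-]] supW.
have [a a0 aV] : exists2 a : R, 0 < a & forall r, V r ->
    (a%:E <= density_ratio t mu x r)%E.
  have lb r : V r -> (ereal_inf (density_ratio t mu x @` V) <=
      density_ratio t mu x r)%E.
    by move=> Vr; apply: ereal_inf_lbound; exists r.
  (* If the infimum is [+oo], any positive constant serves. *)
  case: (ereal_inf _) infV lb => [a a0 lb|_ lb|//].
    by exists a => //; rewrite -lte_fin.
  by exists 1 => // r /lb; apply: le_trans; exact: leey.
have [b bW] : exists b : R, forall r, W r ->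
    (density_ratio t mu x r <= b%:E)%E.
  have ub r : W r -> (density_ratio t mu x r <=
      ereal_sup (density_ratio t mu x @` W))%E.
    by move=> Wr; apply: ereal_sup_ubound; exists r.
  case: (ereal_sup _) supW ub => [b _ ub|//|_ ub]; first by exists b.
  by exists 0 => r /ub/le_trans; apply; exact: leNye.
have /nbhs_ballP[e /= e0 eVW] : nbhs (0 : R) [set r | 0 < r -> V r /\ W r].
  exact: (filterI V0 W0).
(* One integer dominates the upper constant and the inverses of the lower constant and of the
   radius, so countably many classes of points suffice. *)
pose N := Num.bound (Num.max b (Num.max a^-1 e^-1)).
have : Num.max b (Num.max a^-1 e^-1) < N%:R.
  by apply: archi_boundP; rewrite !le_max !invr_ge0 (ltW a0) !orbT.
rewrite !gt_max => /and3P[bN aN eN]; exists N => r /andP[r0 rN].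
have NS : N%:R <= N.+1%:R :> R by rewrite ler_nat.
have Np : 0 < N.+1%:R :> R by rewrite ltr0n.
have rt : 0 < r `^ t by rewrite powR_gt0.
have [||Vr Wr] := eVW r => //.
  rewrite /ball /= sub0r normrN gtr0_norm// (lt_trans rN)//.
  by rewrite invf_plt ?posrE// (lt_le_trans eN).
have := aV r Vr; have := bW r Wr; rewrite /density_ratio.
rewrite lee_pdivrMr// lee_pdivlMr// => Hb Ha; apply/andP; split.
  apply: le_trans Ha; rewrite -EFinM lee_fin ler_wpM2r ?(ltW rt)//.
  by rewrite ltW// invf_plt ?posrE// (lt_le_trans aN).
apply: (le_trans Hb); rewrite -EFinM lee_fin ler_wpM2r ?(ltW rt)//.
by rewrite (le_trans (ltW bN)).
Qed.

(** Half-open cubes of side [d]; the integer indices keep the family countable. *)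
Definition grid_cell (R : realType) (n : nat) (d : R) (q : 'rV[int]_n) :
    set 'rV[R]_n :=
  [set x | forall i, q ord0 i = Num.floor (x ord0 i / d)].

Lemma grid_cell_diam (R : realType) (n : nat) (d : R) (q : 'rV[int]_n) :
  0 < d -> diam_le (grid_cell d q) d.
Proof.
move=> d0 x y xq yq; apply: norm_le_coord => [|i]; first exact: ltW.
have /andP[x1 x2] := floor_itv (x ord0 i / d).
have /andP[y1 y2] := floor_itv (y ord0 i / d).
move: x1 x2 y1 y2; rewrite -xq -yq intrD.
rewrite !ler_pdivlMr// !ltr_pdivrMr// mulrDl !mxE => x1 x2 y1 y2.
by rewrite ler_norml; apply/andP; split; lra.
Qed.

Unset Implicit Arguments.
Set Strict Implicit.

Theorem theoremC (R : realType) (n m : nat) (s t : R)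
    (mu : {outer_measure set 'rV[R]_n -> \bar R})
    (mu_radon : radon mu)
    (hm : (1 <= m <= n - 1)%N)
    (hs : m%:R <= s < n%:R)
    (ht : 0 <= t < s) :
  carried_by_hoelder_cubes m (m%:R / s) (mu_plus t mu).
Proof.
have [_ [muB _]] := mu_radon.
have /andP[m0 mn] := hm; have /andP[ms _] := hs; have /andP[_ ts] := ht.
have n0 : (0 < n)%N by rewrite (leq_trans m0)// (leq_trans mn)// leq_subr.
have nR0 : 0 < n%:R :> R by rewrite ltr0n.
(* Cells this small keep the large ball of the packing argument within the scales below
   [N.+1%:R^-1], where the density bounds hold. *)
pose d N : R := (4 * n%:R * N.+1%:R)^-1.
have d0 N : 0 < d N by rewrite invr_gt0 !mulr_gt0.
have dN N : n%:R * (2 * d N) < N.+1%:R^-1.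
  have -> : n%:R * (2 * d N) = N.+1%:R^-1 / 2.
    by rewrite /d; field; rewrite !lt0r_neq0// ltr0n.
  by rewrite ltr_pdivrMr// ltr_pMr ?ltr1n// invr_gt0.
pose E (p : nat * 'rV[int]_n) :=
  ahlfors_at mu t p.1.+1%:R^-1 p.1.+1%:R p.1.+1%:R^-1 `&` grid_cell (d p.1) p.2.
have /choice[G GP] (p : nat * 'rV[int]_n) :
    exists G, hoelder_cube m (m%:R / s) G /\ E p `<=` G.
  have diamE : diam_le (E p) (d p.1).
    by move=> x y [_ xq] [_ yq]; exact: grid_cell_diam xq yq.
  pose K : R := p.1.+1%:R / p.1.+1%:R^-1 * (4 * n%:R) `^ t.
  suff [G Gh EG] : exists2 G, hoelder_cube m (m%:R / s) G & E p `<=` G.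
    by exists G.
  apply: (@hoelder_cube_cover R m n s t K (d p.1)) => //.
  move=> e r z r0 re ed zE ze sz.
  by apply: (ahlfors_packing muB n0 _ _ (dN p.1) _ r0 re ed zE ze sz) => //
    x [].
exists (range G); split.
- by apply: card_le_trans (card_image_le _ _) _; exact: countableP.
- by move=> _ [p _ <-]; have [] := GP p.
(* The cubes cover every point of the density set, so the uncovered part is empty and not just
   null. *)
rewrite /mu_plus /orestr [X in mu X](_ : _ = set0) ?outer_measure0//.
rewrite -subset0 => x [[lo [_ up]]]; apply.
have [N xN] := density_bounds lo up.
pose q : 'rV[int]_n := \row_i Num.floor (x ord0 i / d N).
exists (G (N, q)); first by exists (N, q).
have [_] := GP (N, q); apply; split => //= i.
by rewrite mxE.
Qed.
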